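(* A group $G$ is finite-by-nilpotent if and only if there are positive integers $k$ and $n$ such that $|x|_k\leq n$ for every $x\in G$.
   Context: For elements of a group, $[x,y]=x^{-1}y^{-1}xy$, and $[x_1,\dots,x_k]=[\dots[[x_1,x_2],x_3]\dots,x_k]$ denotes the left-normed commutator. For a group $G$, an element $a\in G$ and an integer $k\geq 1$, $|a|_k$ denotes the cardinality of the set $\{[a,x_1,\dots,x_k] : x_1,\dots,x_k\in G\}$. A group $G$ is finite-by-nilpotent if it has a finite normal subgroup $N$ such that $G/N$ is nilpotent. *)

(* Defs.v *)
From HB Require Import structures.
From mathcomp Require Import all_boot.
From mathcomp Require Import boolp classical_sets functions cardinality.

Set Implicit Arguments.
Unset Strict Implicit.
Unset Printing Implicit Defensive.

Local Open Scope classical_set_scope.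
Local Open Scope group_scope.
Local Open Scope quotient_scope.

(* Groups are MathComp's [groupType]s, which may be infinite; sets of group
   elements are Prop-valued ([set G]).  MathComp's commutator is
   [~ x, y] = x^-1 * (y^-1 * (x * y)). *)

Record is_subgroup (G : groupType) (H : set G) : Prop := IsSubgroup {
  subgroup1 : H 1;
  subgroupM : forall x y, H x -> H y -> H (x * y);
  subgroupV : forall x, H x -> H x^-1
}.

Record normalSubgroup (G : groupType) := NormalSubgroup {
  normal_set :> set G;
  normal_subgroup : is_subgroup normal_set;
  normalJ : forall x y, normal_set x -> normal_set (x ^ y)
}.

Section Quotient.
Variables (G : groupType) (N : normalSubgroup G).
Implicit Types x y z : G.

Let NM := @subgroupM G N (normal_subgroup N).
Let NV := @subgroupV G N (normal_subgroup N).

(* x ~ y iff x N = y N *)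
Definition same_coset x y : bool := `[< normal_set N (x^-1 * y) >].

Lemma same_cosetP x y : reflect (normal_set N (x^-1 * y)) (same_coset x y).
Proof. exact: asboolP. Qed.

Lemma same_coset_refl : reflexive same_coset.
Proof. by move=> x; apply/same_cosetP; rewrite mulVg; exact: (subgroup1 (normal_subgroup N)). Qed.

Lemma same_coset_sym : symmetric same_coset.
Proof.
move=> x y; apply/same_cosetP/same_cosetP => /NV; by rewrite invgM invgK.
Qed.

Lemma same_coset_trans : transitive same_coset.
Proof.
move=> y x z /same_cosetP xy /same_cosetP yz; apply/same_cosetP.
by have := NM xy yz; rewrite -mulgA mulVKg.
Qed.

Canonical same_coset_equiv :=
  EquivRel same_coset same_coset_refl same_coset_sym same_coset_trans.

Definition quotient_group := {eq_quot same_coset}.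
HB.instance Definition _ := Choice.on quotient_group.
HB.instance Definition _ := EqQuotient.on quotient_group.

Definition quotient_one : quotient_group := lift_cst quotient_group 1.
Definition quotient_mul := lift_op2 quotient_group *%g.
Definition quotient_inv := lift_op1 quotient_group (fun x : G => x^-1).

Canonical pi_quotient_one := PiConst quotient_one.

Lemma pi_mulq : {morph \pi_quotient_group : x y / x * y >-> quotient_mul x y}.
Proof.
move=> x y; unlock quotient_mul; apply/eqmodP => /=; apply/same_cosetP.
have /same_cosetP xx' : same_coset x (repr (\pi_quotient_group x)).
  by apply/eqmodP; rewrite reprK.
have /same_cosetP yy' : same_coset y (repr (\pi_quotient_group y)).
  by apply/eqmodP; rewrite reprK.
have := NM (normalJ y xx') yy'.
by rewrite conjgE invgM !mulgA mulgK.
Qed.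
Canonical pi_quotient_mul := PiMorph2 pi_mulq.

Lemma pi_invq : {morph \pi_quotient_group : x / x^-1 >-> quotient_inv x}.
Proof.
move=> x; unlock quotient_inv; apply/eqmodP => /=; apply/same_cosetP.
have /same_cosetP xx' : same_coset (repr (\pi_quotient_group x)) x.
  by apply/eqmodP; rewrite reprK.
have := normalJ x^-1 xx'.
by rewrite conjgE invgK !mulgA mulgK.
Qed.
Canonical pi_quotient_inv := PiMorph1 pi_invq.

Lemma quotient_mulA : associative quotient_mul.
Proof. by move=> x y z; rewrite -[x]reprK -[y]reprK -[z]reprK !piE mulgA. Qed.

Lemma quotient_mul1 : left_id quotient_one quotient_mul.
Proof. by move=> x; rewrite -[x]reprK !piE mul1g. Qed.

Lemma quotient_mulr1 : right_id quotient_one quotient_mul.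
Proof. by move=> x; rewrite -[x]reprK !piE mulg1. Qed.

Lemma quotient_mulV : left_inverse quotient_one quotient_inv quotient_mul.
Proof. by move=> x; rewrite -[x]reprK !piE mulVg. Qed.

Lemma quotient_mulrV : right_inverse quotient_one quotient_inv quotient_mul.
Proof. by move=> x; rewrite -[x]reprK !piE mulgV. Qed.

HB.instance Definition _ := isGroup.Build quotient_group
  quotient_mulA quotient_mul1 quotient_mulr1 quotient_mulV quotient_mulrV.

Lemma pi_quotient1 : \pi_quotient_group 1 = 1.
Proof. by rewrite -[RHS]/quotient_one piE. Qed.

Lemma pi_quotientM : {morph \pi_quotient_group : x y / x * y}.
Proof. exact: pi_mulq. Qed.

End Quotient.

(* Index n stands for the usual gamma_(n+1). *)
Fixpoint lower_central (G : groupType) (n : nat) : set G :=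
  if n is n'.+1 then
    smallest (@is_subgroup G)
      [set [~ x, y] | x in @lower_central G n' & y in [set: G]]
  else [set: G].

Definition nilpotent_group (G : groupType) : Prop :=
  exists n, @lower_central G n = [set 1].

Definition finite_by_nilpotent (G : groupType) : Prop :=
  exists N : normalSubgroup G,
    finite_set N /\ nilpotent_group (quotient_group N).

(* The set of all [a, x_1, ..., x_k], left-normed. *)
Definition commutator_set (G : groupType) (k : nat) (a : G) : set G :=
  [set foldl commg a xs | xs in [set: k.-tuple G]].

(* Main.v *)
Require Import Defs.
From HB Require Import structures.
From mathcomp Require Import all_boot.
From mathcomp Require Import boolp classical_sets functions cardinality.

(** Write S_k(a) for the set of values [a, x_1, ..., x_k], and Z_j(K), for a
normal subgroup K, for the normal subgroup of the a with S_j(a) contained in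
K, that is, the preimage of the j-th centre of G / K.  If N is finite and
G / N has class c, then S_c(x) lies in N for every x, which bounds it.

Conversely, let every S_k(a) have at most n elements.

Torsion.  Every value c = [a, x_1, ..., x_k] has finite order.  Write
c = [d, x]; the class of d is finite because d^-1 d^g lies in S_k(a).  So the
centralizer C of that class has finite index, D = C_G(C) contains the class, and
the central subgroup C :&: D =: A of D has finite index in D.  The transfer
D -> A is a homomorphism, and it shows that c^N = [d^N, x] with d^N in A for some
N > 0 ([central_finite_index_power]).  For u in A the powers of
[u, x, ..., x] are the values [x, u^-j, x, ..., x], so that [u, x, ..., x] has
finite order; since a power of x centralizes A, the factors x can be stripped
one at a time ([torsion_commg_step]), until [u, x] has finite order
([fc_commg_torsion]).

Finite closures.  Values also have finite conjugacy classes, so Dicman's lemma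
([dicman]) puts every S_k(a), together with any given finite normal subgroup,
inside a finite normal subgroup: a becomes an element of Z_k(K) for some finite
K ([finite_normal_cover]).

Extremal argument ([finite_normal_residual]).  Choose a finite normal subgroup
K0 for which the largest number j of nontrivial, pairwise distinct values of
S_k(b) modulo K0, over all b, is as small as possible.  Suppose that some
[a, x, x_2, ..., x_k] is not in K0, and take K >= K0 finite normal with a and x
in Z = Z_k(K).  By minimality some b has j such values modulo K, and then so
does z b for every z in Z, since S_k(z b) and S_k(b) agree modulo K.  A value of
S_k(z b) in K but not in K0 would be one more value modulo K0, against the
choice of j; so S_k(z b) meets K inside K0.  For w in Z all the values
[z b, w, y_2, ..., y_k] lie in K, hence in K0, which says that [z b, w] is in
Z_{k-1}(K0).  As [z b, w] = [z, w]^b [b, w], also [z, w] is in Z_{k-1}(K0) for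
all z and w in Z.  With z = a and w = x this contradicts the choice of a and x.
Hence K0 contains all the sets S_k(a), and G / K0 is nilpotent. *)

Set Implicit Arguments.
Unset Strict Implicit.
Unset Printing Implicit Defensive.

Local Open Scope classical_set_scope.
Local Open Scope group_scope.

(** * Finite sets and words *)

Section FiniteSets.

Lemma pigeonhole_nat (T : Type) (A : set T) (f : nat -> T) :
  finite_set A -> (forall i, A (f i)) -> exists i j, (i < j)%N /\ f i = f j.
Proof.
move=> Afin fA; apply: contrapT => noij; apply: infinite_nat.
have -> : [set: nat] = f @^-1` A by apply/seteqP; split=> // i _; apply: fA.
apply: finite_preimage => // i j _ _ fij.
by case: (ltngtP i j) => // [ij|ji]; case: noij; [exists i, j | exists j, i].
Qed.

Lemma finite_words (T : eqType) (Y : set T) (m : nat) :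
  finite_set Y ->
  finite_set [set s : seq T | (size s <= m)%N /\ forall y, y \in s -> Y y].
Proof.
move=> Yfin; elim: m => [|m IHm].
  by apply: (@sub_finite_set _ _ [set [::]]) => // -[|y s] [].
apply: (@sub_finite_set _ _
  ([set [::]] `|` [set y :: s | y in Y & s in
    [set s : seq T | (size s <= m)%N /\ forall y, y \in s -> Y y]])).
  move=> [|y s] [sz sY]; first by left.
  right; exists y; first by apply: sY; rewrite mem_head.
  by exists s => //; split=> // z zs; apply: sY; rewrite inE zs orbT.
by rewrite finite_setU; split=> //; apply: finite_image2.
Qed.

(** Dicman's lemma uses this contrapositively: a word that is long compared
with its alphabet repeats some letter more than [e] times. *)
Lemma size_le_count (T : eqType) (e : nat) (s r : seq T) : {subset s <= r} ->
  (forall x, x \in r -> (count_mem x s <= e)%N) -> (size s <= size r * e)%N.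
Proof.
elim: r s => [|y r IHr] s sr cnt.
  by case: s sr {cnt} => // x s /(_ x); rewrite mem_head => /(_ isT).
rewrite /= mulSn -(count_predC (pred1 y)) leq_add ?cnt ?mem_head//.
rewrite -size_filter IHr// => [x|x xr].
  rewrite mem_filter => /andP[/= nxy /sr].
  by rewrite inE (negbTE nxy).
rewrite count_filter (leq_trans _ (cnt x _)) ?inE ?xr ?orbT//.
by apply: sub_count => z /andP[].
Qed.

End FiniteSets.

(** * Iterated centres modulo a normal subgroup *)

Section Groups.
Variable G : groupType.
Implicit Types (g h x y z : G) (H K : normalSubgroup G).

Lemma nsg1 H : normal_set H 1.
Proof. exact: subgroup1 (normal_subgroup H). Qed.

Lemma nsgM H x y : normal_set H x -> normal_set H y -> normal_set H (x * y).
Proof. exact: subgroupM (normal_subgroup H) _ _. Qed.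

Lemma nsgV H x : normal_set H x -> normal_set H x^-1.
Proof. exact: subgroupV (normal_subgroup H) _. Qed.

Lemma nsgJ H x y : normal_set H (x ^ y) <-> normal_set H x.
Proof.
by split=> [/(@normalJ _ H _ y^-1)|]; [rewrite conjgK | exact: normalJ].
Qed.

Lemma nsgX H x n : normal_set H x -> normal_set H (x ^+ n).
Proof.
move=> Hx; elim: n => [|n IHn]; first exact: nsg1.
by rewrite expgS; apply: nsgM.
Qed.

Lemma commMg x y z : [~ x * y, z] = [~ x, z] ^ y * [~ y, z].
Proof. by rewrite !commgEl !conjgE invgM !mulgA !mulgK. Qed.

Lemma commVg x z : [~ x^-1, z] = ([~ x, z] ^ x^-1)^-1.
Proof.
apply/esym/mulg1_eq.
by rewrite -commMg mulgV comm1g.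
Qed.

(** The preimage in G of the centre of G / H. *)
Definition center_mod_set H : set G := [set a | forall x, normal_set H [~ a, x]].

Lemma center_mod_subgroup H : is_subgroup (center_mod_set H).
Proof.
split=> [x|a b Ha Hb x|a Ha x]; first by rewrite comm1g; apply: nsg1.
  by rewrite commMg; apply: nsgM => //; apply/nsgJ.
by rewrite commVg; apply/nsgV/nsgJ.
Qed.

Lemma center_modJ H x y : center_mod_set H x -> center_mod_set H (x ^ y).
Proof.
by move=> Hx z; rewrite -[z](conjgKV y) -conjRg; apply/nsgJ.
Qed.

Definition center_mod H := NormalSubgroup (center_mod_subgroup H) (@center_modJ H).

Lemma iter_center_modP H j a :
  normal_set (iter j center_mod H) a <->
  forall xs : seq G, size xs = j -> normal_set H (foldl commg a xs).
Proof.
elim: j a => [|j IHj] a.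
  by split=> [Ha [|]//|/(_ [::])]; apply.
rewrite iterS; split=> [Ha [|x xs]//= [sxs]|Ha /= x].
  exact: (proj1 (IHj _) (Ha x)).
by apply/IHj => xs sxs; apply: (Ha (x :: xs)); rewrite /= sxs.
Qed.

(** A factor from the j-th centre modulo H drops out of commutators of weight
j + 1: by [commMg], [a b, x] = [a, x]^b [b, x], and [a, x]^b is in the previous
centre. *)
Lemma foldl_commg_mull H (xs : seq G) a b :
  normal_set (iter (size xs) center_mod H) a ->
  same_coset H (foldl commg b xs) (foldl commg (a * b) xs).
Proof.
elim: xs a b => [|x xs IHxs] a b /= Ha.
  by apply/same_cosetP; rewrite -conjgE; apply/nsgJ.
by rewrite commMg; apply: IHxs; apply/nsgJ; apply: Ha.
Qed.

(** * Elements of finite order and Dicman's lemma *)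

Definition torsion x := exists2 n, (0 < n)%N & x ^+ n = 1.

Lemma finite_powers_torsion (A : set G) x :
  finite_set A -> (forall n, A (x ^+ n)) -> torsion x.
Proof.
move=> Afin /(pigeonhole_nat Afin)[i [j [ij eqx]]].
exists (j - i)%N; first by rewrite subn_gt0.
by rewrite expgnFr ?(ltnW ij)// eqx mulgV.
Qed.

Lemma torsionX x n : (0 < n)%N -> torsion (x ^+ n) -> torsion x.
Proof.
move=> n0 [m m0 xm]; exists (n * m)%N; first by rewrite muln_gt0 n0.
by rewrite expgnA.
Qed.

Lemma torsionJ x y : torsion x -> torsion (x ^ y).
Proof. by move=> [n n0 xn]; exists n => //; rewrite -conjXg xn conj1g. Qed.

Definition conj_closed (Y : set G) := forall x y, Y x -> Y (x ^ y).

(** Moving all occurrences of [y] to the front conjugates the letters they pass,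
which remain in the conjugation-closed alphabet [Y]. *)
Lemma collect_letter (Y : set G) (y : G) (s : seq G) : conj_closed Y ->
  (forall x, x \in s -> Y x) ->
  exists s' : seq G, [/\ (forall x, x \in s' -> Y x),
    (size s' + count_mem y s)%N = size s &
    \prod_(x <- s) x = y ^+ count_mem y s * \prod_(x <- s') x].
Proof.
move=> YJ; elim: s => [|x s IHs] sY.
  by exists [::]; split=> //; rewrite big_nil mul1g.
have [|s' [s'Y szs' eqs']] := IHs.
  by move=> z zs; apply: sY; rewrite inE zs orbT.
rewrite big_cons eqs' /=; have [->|nxy] := eqVneq x y.
  exists s'; split=> //; first by rewrite add1n addnS szs'.
  by rewrite mulgA -expgS.
exists (x ^ (y ^+ count_mem y s) :: s'); split=> [z||].
- rewrite inE => /orP[/eqP->|/s'Y//].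
  by apply: YJ; apply: sY; rewrite mem_head.
- by rewrite /= add0n addSn szs'.
by rewrite add0n big_cons 2!mulgA -conjgC.
Qed.

Definition generated (Y : set G) : set G :=
  [set \prod_(x <- s) x | s in [set s : seq G | forall x, x \in s -> Y x]].

Lemma common_exponent (r : seq G) : (forall y, y \in r -> torsion y) ->
  exists2 e, (0 < e)%N & forall y, y \in r -> y ^+ e = 1.
Proof.
elim: r => [|y r IHr] tor; first by exists 1%N.
have [|e e0 re] := IHr.
  by move=> z zr; apply: tor; rewrite inE zr orbT.
have [f f0 yf] := tor y (mem_head _ _).
exists (f * e)%N; first by rewrite muln_gt0 f0.
move=> z; rewrite inE => /orP[/eqP->|/re ze]; first by rewrite expgnA yf expg1n.
by rewrite mulnC expgnA ze expg1n.
Qed.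

(** Every word in [Y] can be shortened until no letter occurs more than [e]
times, where [e] is a common exponent of [Y]: the occurrences of a more frequent
letter are collected and [e] of them cancel.  So the subgroup generated by [Y]
is the set of products of words of bounded length. *)
Lemma dicman (Y : set G) : finite_set Y -> conj_closed Y ->
  (forall y, Y y -> torsion y) ->
  exists K : normalSubgroup G, finite_set K /\ Y `<=` K.
Proof.
move=> /[dup] Yfin /finite_seqP[r Yr] YJ Ytor.
have [|e e0 re] := @common_exponent r.
  by move=> y yr; apply: Ytor; rewrite Yr.
have short (s : seq G) : (forall x, x \in s -> Y x) ->
    exists s', [/\ (forall x, x \in s' -> Y x), (size s' <= size r * e)%N &
      \prod_(x <- s) x = \prod_(x <- s') x].
  have [m] := ubnP (size s); elim: m s => // m IHm s sm sY.
  have [long|] := ltnP (size r * e) (size s); last by exists s.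
  have [y yr cnt] : exists2 y, y \in r & (e < count_mem y s)%N.
    apply: contrapT => no; suff : (size s <= size r * e)%N by rewrite leqNgt long.
    apply: size_le_count => [x /sY|x xr]; first by rewrite Yr.
    by rewrite leqNgt; apply/negP => ?; apply: no; exists x.
  have [s' [s'Y szs' ->]] := collect_letter y YJ sY.
  have [|x|s'' [s''Y szs'' eqs'']] := IHm (nseq (count_mem y s - e) y ++ s').
  - rewrite size_cat size_nseq; move: sm; rewrite ltnS -szs' => /(leq_trans _); apply.
    by rewrite addnC ltn_add2l ltn_subrL e0 (leq_trans _ cnt).
  - by rewrite mem_cat mem_nseq => /orP[/andP[_ /eqP->]|/s'Y//]; rewrite Yr.
  exists s''; split=> //; rewrite -eqs'' big_cat big_nseq iter_mulg_1 /=.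
  by rewrite expgnFr ?(ltnW cnt)// re// invg1 mulg1.
have gsub : is_subgroup (generated Y).
  split=> [|_ _ [s sY <-] [t tY <-]|_ [s sY <-]].
  - by exists [::] => //; rewrite big_nil.
  - exists (s ++ t); last by rewrite big_cat.
    by move=> x; rewrite mem_cat => /orP[/sY|/tY].
  elim: s sY => [|x s IHs] sY.
    by exists [::] => //; rewrite big_nil invg1.
  have [|t tY tE] := IHs; first by move=> z zs; apply: sY; rewrite inE zs orbT.
  have Yx : Y x by apply: sY; rewrite mem_head.
  (* x^-1 = x^(e-1) is a product of letters *)
  exists (t ++ nseq e.-1 x).
    by move=> z; rewrite mem_cat mem_nseq => /orP[/tY//|/andP[_ /eqP->]].
  rewrite big_cat big_nseq iter_mulg_1 big_cons invgM tE; congr (_ * _).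
  apply/esym/mulg1_eq; rewrite -expgS prednK// re//.
  by move: Yx; rewrite Yr.
have gnorm x y : generated Y x -> generated Y (x ^ y).
  move=> [s sY <-]; exists [seq z ^ y | z <- s].
    by move=> _ /mapP[z /sY Yz ->]; apply: YJ.
  by rewrite big_map conjg_prod.
exists (NormalSubgroup gsub gnorm); split=> /=.
  apply: (@sub_finite_set _ _ ((fun s : seq G => \prod_(x <- s) x) @`
    [set s : seq G | (size s <= size r * e)%N /\ forall y, y \in s -> Y y])).
    by move=> _ [s /short[t [tY szt ->]] <-]; exists t.
  exact/finite_image/finite_words.
move=> y Yy; exists [:: y]; last by rewrite big_seq1.
by move=> x; rewrite inE => /eqP->.
Qed.

End Groups.

Arguments center_mod {G} H.

(** * Transfer to a central subgroup of finite index *)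

Section Transfer.
Variable G : groupType.
Implicit Types (x y z : G).

Lemma prod_commute_all (s : seq G) x :
  (forall y, y \in s -> commute x y) -> commute x (\prod_(y <- s) y).
Proof.
by move=> xs; rewrite big_seq_cond; apply: commute_prod => y /andP[/xs].
Qed.

(** Products in a nonabelian group can be reordered when the factors commute
pairwise; the factors of the transfer do. *)
Lemma perm_prod_commute (s t : seq G) :
  (forall x y, x \in s -> y \in s -> commute x y) -> perm_eq s t ->
  \prod_(x <- s) x = \prod_(x <- t) x.
Proof.
move=> sC pst.
pose P (u : seq G) := (forall x y, x \in u -> y \in u -> commute x y) /\
  \prod_(x <- s) x = \prod_(x <- u) x.
suff [] : P t by [].
apply: (@catCA_perm_ind _ P _ s t) => // u v w [uC eqs]; split.
  by move=> x y; rewrite -![_ \in v ++ _](perm_mem (permEl (perm_catCA u v w)));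
    apply: uC.
rewrite eqs !big_cat /= !mulgA; congr (_ * _).
apply: prod_commute_all => y yv; apply/commute_sym/prod_commute_all => x xu.
by apply: uC; rewrite !mem_cat ?xu ?yv ?orbT.
Qed.

Variables (D A : set G).
Hypotheses (Dsub : is_subgroup D) (Asub : is_subgroup A) (AD : A `<=` D).
Hypothesis (AC : forall a x, A a -> D x -> commute a x).
(* The finite index of A in D is witnessed by a map phi with finitely many
   values, whose fibres lie in single left cosets of A. *)
Variables (I : Type) (phi : G -> I).
Hypothesis (phi_fin : finite_set (phi @` D)).
Hypothesis (phiA : forall x y, D x -> D y -> phi x = phi y -> A (x^-1 * y)).

Let DM := subgroupM Dsub.
Let DV := subgroupV Dsub.
Let AM := subgroupM Asub.
Let AV := subgroupV Asub.

Definition coset_rep x := xget 1 [set y | D y /\ A (x^-1 * y)].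

Lemma coset_repP x : D x -> D (coset_rep x) /\ A (x^-1 * coset_rep x).
Proof.
move=> Dx; apply: (@xgetPex _ 1 [set y | D y /\ A (x^-1 * y)]).
by exists x; split=> //; rewrite mulVg; apply: subgroup1.
Qed.

Lemma coset_rep_eq x y : A (x^-1 * y) -> coset_rep x = coset_rep y.
Proof.
move=> Axy; congr xget; apply/seteqP; split=> z [Dz Az]; split=> //.
  suff -> : y^-1 * z = (x^-1 * y)^-1 * (x^-1 * z) by apply: AM => //; apply: AV.
  by rewrite invgM invgK -mulgA mulVKg.
have -> : x^-1 * z = (x^-1 * y) * (y^-1 * z) by rewrite -mulgA mulVKg.
exact: AM.
Qed.

(** V x is the product, over a transversal T of D / A, of the elements c x t of
A defined by x t = t' (c x t), where t' in T represents the coset of x t.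
Multiplicativity follows from (x y) t = x t' (c y t), because t |-> t' permutes T
and A is commutative. *)
Lemma transfer : exists (V : G -> G) (q : nat), [/\ (0 < q)%N,
  forall x, D x -> A (V x),
  forall x y, D x -> D y -> V (x * y) = V x * V y &
  forall x, A x -> V x = x ^+ q].
Proof.
have [r rE] : exists r : seq G, coset_rep @` D = [set` r].
  apply/finite_seqP; apply: (@sub_finite_set _ _
    ((fun i => coset_rep (xget 1 [set x | D x /\ phi x = i])) @` (phi @` D))).
    move=> _ [x Dx <-]; exists (phi x); first by exists x.
    have [Dy phiy] := @xgetPex _ 1 [set y | D y /\ phi y = phi x]
      (ex_intro _ x (conj Dx erefl)).
    by apply: coset_rep_eq; apply: phiA.
  exact: finite_image.
pose T := undup r.
have TP x : (x \in T) <-> exists2 y, D y & coset_rep y = x.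
  by rewrite mem_undup; change (x \in r <-> (coset_rep @` D) x); rewrite rE.
have TD x : x \in T -> D x by move=> /TP[y /coset_repP[? _] <-].
have Tid x : x \in T -> coset_rep x = x.
  move=> /TP[y Dy <-]; apply/esym/coset_rep_eq; exact: (coset_repP Dy).2.
have repT x : D x -> coset_rep x \in T by move=> Dx; apply/TP; exists x.
pose tau x t := coset_rep (x * t).
pose c x t := (tau x t)^-1 * (x * t).
have cA x t : D x -> t \in T -> A (c x t).
  move=> Dx Tt; have := AV (coset_repP (DM Dx (TD _ Tt))).2.
  by rewrite invgM invgK.
have tau_perm x : D x -> perm_eq (map (tau x) T) T.
  move=> Dx; have Tuniq : uniq (map (tau x) T).
    rewrite map_inj_in_uniq ?undup_uniq// => s t Ts Tt eqst.
    rewrite -(Tid s Ts) -(Tid t Tt); apply: coset_rep_eq.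
    have := AM (AV (cA x s Dx Ts)) (cA x t Dx Tt).
    by rewrite /c eqst invgM invgK -mulgA mulVKg invgM !mulgA mulgVK.
  suff sub : {subset map (tau x) T <= T}.
    apply: uniq_perm => //; first exact: undup_uniq.
    by apply: (uniq_min_size Tuniq sub _).2; rewrite size_map.
  by move=> _ /mapP[t Tt ->]; apply/repT/DM => //; apply: TD.
pose V x := \prod_(t <- T) c x t.
have VA x : D x -> A (V x).
  move=> Dx; rewrite /V big_seq; apply: big_ind => [||t Tt].
  - exact: subgroup1.
  - exact: AM.
  exact: cA.
exists V, (size T); split=> // [|x y Dx Dy|x Ax].
- by have := repT 1 (subgroup1 Dsub); case: (T).
- have -> : V x = \prod_(t <- T) c x (tau y t).
    rewrite -(big_map (tau y) predT (c x)) /V -2!(big_map (c x) predT id).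
    apply/esym/perm_prod_commute; last exact/perm_map/tau_perm.
    move=> _ _ /mapP[_ /mapP[s Ts ->] ->] /mapP[_ /mapP[t Tt ->] ->].
    have TtauT z : z \in T -> tau y z \in T by move=> Tz; apply/repT/DM/TD.
    by apply: AC; [|apply: AD]; apply: cA => //; apply: TtauT.
  have TtauT z : z \in T -> tau y z \in T by move=> Tz; apply/repT/DM/TD.
  rewrite /V big_seq [X in _ = X * _]big_seq [X in _ = _ * X]big_seq.
  rewrite -prodgM_commute => [|s t Ts Tt].
    apply: eq_bigr => t Tt; rewrite /c.
    have -> : tau (x * y) t = tau x (tau y t).
      rewrite /tau; apply/esym/coset_rep_eq.
      have -> : (x * coset_rep (y * t))^-1 * (x * y * t) = c y t.
        by rewrite /c invgM -!mulgA mulKg.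
      exact: cA.
    by rewrite /c -!mulgA mulVKg.
  by apply: AC; [|apply: AD]; apply: cA => //; apply: TtauT.
rewrite /V big_seq (eq_bigr (fun=> x)) => [|t Tt].
  by rewrite -big_seq big_const_seq count_predT iter_mulg_1.
have Dt := TD t Tt; have cxt : x * t = t * x by apply: AC.
rewrite /c /tau -[coset_rep (x * t)](@coset_rep_eq t).
  by rewrite Tid// cxt mulKg.
by rewrite cxt mulKg.
Qed.

(** Two powers of x lie in the same coset, by the pigeonhole principle. *)
Lemma finite_index_power x : D x -> exists2 p, (0 < p)%N & A (x ^+ p).
Proof.
move=> Dx; have DX n : D (x ^+ n).
  elim: n => [|n IHn]; first exact: subgroup1.
  by rewrite expgS; apply: DM.
have [|i [j [ij phiij]]] := pigeonhole_nat (f := fun n => phi (x ^+ n)) phi_fin.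
  by move=> n; exists (x ^+ n).
exists (j - i)%N; first by rewrite subn_gt0.
by have := phiA (DX i) (DX j) phiij; rewrite -{1}(subnKC (ltnW ij)) expgnDr mulKg.
Qed.

(** For u with u^P in A the transfer satisfies V u ^ P = V (u^P) = u^(P q), where q
is the index.  With P common to x, y and x^-1 y, the map u |-> u^(P q) is therefore
the restriction of a homomorphism to these three elements. *)
Lemma central_finite_index_power x y : D x -> D y ->
  exists2 N, (0 < N)%N &
    [/\ A (x ^+ N), A (y ^+ N) & (x^-1 * y) ^+ N = x ^- N * y ^+ N].
Proof.
move=> Dx Dy; have Dxy : D (x^-1 * y) by apply: DM => //; apply: DV.
have [V [q [q0 VA VM Vq]]] := transfer.
have AX u n : A u -> A (u ^+ n).
  move=> Au; elim: n => [|n IHn]; first exact: subgroup1.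
  by rewrite expgS; apply: AM.
have VX u n : D u -> V (u ^+ n) = V u ^+ n.
  move=> Du; elim: n => [|n IHn].
    by rewrite Vq ?expg1n//; apply: subgroup1.
  rewrite !expgS VM ?IHn//; elim: (n) => [|m]; first exact: subgroup1.
  by rewrite expgS; apply: DM.
have [a a0 Aa] := finite_index_power Dx.
have [b b0 Ab] := finite_index_power Dy.
have [d d0 Ad] := finite_index_power Dxy.
pose P := (a * b * d)%N.
have PE u n m : A (u ^+ n) -> P = (n * m)%N -> A (u ^+ P).
  by move=> Au ->; rewrite expgnA; apply: AX.
have AxP : A (x ^+ P) by apply: (PE _ _ (b * d)%N Aa); rewrite mulnA.
have AyP : A (y ^+ P) by apply: (PE _ _ (a * d)%N Ab); rewrite /P mulnA (mulnC b).
have AxyP : A ((x^-1 * y) ^+ P) by apply: (PE _ _ (a * b)%N Ad); rewrite /P mulnC.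
have VP u : D u -> A (u ^+ P) -> V u ^+ P = u ^+ (P * q).
  by move=> Du Au; rewrite -(VX _ _ Du) (Vq _ Au) -expgnA.
exists (P * q)%N; first by rewrite !muln_gt0 a0 b0 d0.
split; [by rewrite (expgnA _ P q); apply: AX..|].
rewrite -!VP//.
have VxA := VA _ Dx; have VxyA := VA _ Dxy.
have -> : V y = V x * V (x^-1 * y) by rewrite -VM// mulVKg.
rewrite expgMn ?mulKg//; apply: AC => //; exact: AD.
Qed.

End Transfer.

(** * Commutators of elements with finitely many conjugates *)

Section Torsion.
Variable G : groupType.
Implicit Types (d x y z g h : G).

Definition conj_class x : set G := range (conjg x).

Lemma conj_classJ x : conj_closed (conj_class x).
Proof. by move=> _ y [g _ <-]; exists (g * y) => //; rewrite conjgM. Qed.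

Definition cent (S : set G) : set G := [set g | forall s, S s -> commute g s].

Lemma cent_subgroup S : is_subgroup (cent S).
Proof.
split=> [s _|x y cx cy s Ss|x cx s Ss]; apply: commute_sym.
- exact: commute1.
- by apply: commuteM; apply: commute_sym; [apply: cx | apply: cy].
by apply: commuteV; apply: commute_sym; apply: cx.
Qed.

Lemma centJ S : conj_closed S -> conj_closed (cent S).
Proof.
move=> SJ x y cx s Ss; have := cx _ (SJ s y^-1 Ss).
by rewrite /commute => /(congr1 (conjg^~ y)) /=;
  rewrite conjMg conjgKV [RHS]conjMg conjgKV.
Qed.

(** The centralizer of a finite conjugation-closed set [Y] has finite index: its
cosets are determined by the permutation that they induce on [Y], recorded here
as the list of the conjugates of an enumeration of [Y]. *)
Lemma cent_conj_finite (Y : set G) : finite_set Y -> conj_closed Y ->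
  exists phi : G -> seq G, finite_set (range phi) /\
    forall g h, phi g = phi h -> cent Y (g^-1 * h).
Proof.
move=> /[dup] Yfin /finite_seqP[r Yr] YJ.
exists (fun g => [seq y ^ g | y <- r]); split=> [|g h /eq_in_map eqgh y Yy].
  apply: sub_finite_set (finite_words (size r) Yfin) => _ [g _ <-].
  rewrite /= size_map; split=> // _ /mapP[y yr ->].
  by apply: YJ; rewrite Yr.
apply/commute_sym/commgP; rewrite -conjg_fix conjgM.
have : y ^ g^-1 \in r by have := YJ _ g^-1 Yy; rewrite Yr.
by move=> /eqgh; rewrite conjgKV => <-.
Qed.

Lemma commXg_commute x y n : commute x (x ^ y) -> [~ x ^+ n, y] = [~ x, y] ^+ n.
Proof.
move=> cxy; rewrite !commgEl expgMn ?expVgn ?conjXg//.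
by apply/commute_sym/commuteV/commute_sym.
Qed.

(** Put u = v^t, where t is the order of [v, x, x].  Then w = [u, x] = [v, x]^t is
fixed by x, so u conjugated by x^e is u w^e.  As x^e fixes u, w^e = 1. *)
Lemma torsion_commg_step x v e : (0 < e)%N -> commute (x ^+ e) v ->
  commute v (v ^ x) -> commute [~ v, x] ([~ v, x] ^ x) ->
  torsion [~ v, x, x] -> torsion [~ v, x].
Proof.
move=> e0 xev cv cw [t t0 wt].
exists (t * e)%N; rewrite ?muln_gt0 ?t0// expgnA -commXg_commute//.
set u := v ^+ t; set w := [~ u, x].
have wx : w ^ x = w.
  by apply/conjg_fixP; rewrite /w /u commXg_commute// commXg_commute// wt.
have uxi i : u ^ (x ^+ i) = u * w ^+ i.
  elim: i => [|i IHi]; first by rewrite conjg1 mulg1.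
  by rewrite expgSr conjgM IHi conjMg (conjXg w) wx expgS mulgA /w commgEl mulVKg.
have : u ^ (x ^+ e) = u.
  by apply/conjg_fixP/commgP/commute_sym; rewrite /u; apply: commuteX.
by rewrite uxi => /(canRL (mulKg _)); rewrite mulVg.
Qed.

(** The transfer replaces d by a power a of d in the abelian normal subgroup
C :&: D, where commutation with x is a homomorphism.  There
[x, a^-j, x, ..., x] = [a, x, x, ..., x]^j takes finitely many values. *)
Lemma fc_commg_torsion m d x : finite_set (conj_class d) ->
  (forall y, finite_set (range (fun j => foldl commg x (y ^+ j :: nseq m x)))) ->
  torsion [~ d, x].
Proof.
move=> dfin xfin.
have [phi [phifin phiP]] := cent_conj_finite dfin (@conj_classJ d).
set C := cent (conj_class d) in phiP; set D := cent C.
have CJ : conj_closed C by apply/centJ/conj_classJ.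
have DJ : conj_closed D by apply: centJ.
have Asub : is_subgroup (C `&` D).
  have [C1 CM CV] := cent_subgroup (conj_class d).
  have [D1 DM DV] := cent_subgroup C.
  split=> [//|u v [Cu Du] [Cv Dv]|u [Cu Du]]; first by split; [apply: CM|apply: DM].
  by split; [apply: CV|apply: DV].
have AJ : conj_closed (C `&` D).
  by move=> u v [Cu Du]; split; [apply: CJ | apply: DJ].
have AC u v : (C `&` D) u -> (C `&` D) v -> commute u v.
  by move=> [_ Du] [Cv _]; apply: Du.
have Dd g : D (d ^ g).
  by move=> c Cc; apply: commute_sym; apply: Cc; exists g.
have [N N0 [dNA _]] : exists2 N, (0 < N)%N &
    [/\ (C `&` D) (d ^+ N), (C `&` D) ((d ^ x) ^+ N) &
        (d^-1 * d ^ x) ^+ N = d ^- N * (d ^ x) ^+ N].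
  apply: (@central_finite_index_power _ D _ _ _ _ _ _ phi).
  - exact: cent_subgroup.
  - exact: Asub.
  - by move=> u [].
  - by move=> u v [Cu _] Dv; apply/commute_sym; apply: Dv.
  - by apply: sub_finite_set phifin => _ [g _ <-]; exists g.
  - move=> g h Dg Dh /phiP Cgh; split=> //.
    have [_ DM DV] := cent_subgroup C.
    by apply: DM => //; apply: DV.
  - by have := Dd 1; rewrite conjg1.
  - exact: Dd.
rewrite -conjXg -!commgEl => dNx; apply: (torsionX N0); rewrite dNx.
have [e e0 xe] : exists2 e, (0 < e)%N & C (x ^+ e).
  apply: (@finite_index_power _ setT C _ _ phi) => //.
  by move=> g h _ _; apply: phiP.
set a := d ^+ N in dNA dNx *.
(* b i = [a, x, ..., x] with i factors x *)
pose b i := iter i (fun v => [~ v, x]) a.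
have bA i : (C `&` D) (b i).
  elim: i => [//|i IHi]; rewrite /b iterS commgEl.
  by apply: (subgroupM Asub); [apply: (subgroupV Asub) | apply: AJ].
have bX i j : iter i (fun v => [~ v, x]) (b 1%N ^+ j) = b i.+1 ^+ j.
  elim: i => [//|i IHi]; rewrite iterS IHi commXg_commute//.
  by apply: AC => //; apply: AJ.
have foldE u i : foldl commg u (nseq i x) = iter i (fun v => [~ v, x]) u.
  by elim: i u => [//|i IHi] u; rewrite iterSr /= IHi.
have bfoldl j : b m.+1 ^+ j = foldl commg x ((a^-1) ^+ j :: nseq m x).
  rewrite /= -(invgR (a^-1 ^+ j) x) (expVgn a j).
  have -> : [~ a ^- j, x] = (b 1%N ^+ j)^-1.
    have caj : commute (a ^+ j) ((a ^+ j) ^ x).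
      rewrite conjXg; apply/commuteX2/AC => //; exact: AJ.
    rewrite -commXg_commute; last by apply: AC => //; apply: AJ.
    rewrite !commgEl invgM !invgK conjVg; exact: commuteV.
  by rewrite invgK foldE bX.
have tor i : torsion (b i.+1) -> torsion (b 1%N).
  elim: i => // i IHi tb; apply: IHi; apply: (torsion_commg_step e0 _ _ _ tb).
  - apply: commute_sym; have [_ Db] := bA i; exact: Db.
  - by apply: AC => //; apply: AJ.
  by apply: (AC _ _ (bA i.+1)); apply: AJ; apply: (bA i.+1).
apply: (tor m); apply: (finite_powers_torsion (xfin a^-1)) => j.
by exists j => //; rewrite bfoldl.
Qed.

End Torsion.

(** * Commutator values and the lower central series *)

Section Trivial.
Variable G : groupType.

Lemma set1_subgroup : is_subgroup [set (1 : G)].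
Proof. by split=> [//|_ _ -> ->|_ ->]; rewrite /= ?mulg1 ?invg1. Qed.

Lemma set1J (x y : G) : [set (1 : G)] x -> [set (1 : G)] (x ^ y).
Proof. by move=> ->; rewrite /= conj1g. Qed.

Definition trivial_subgroup := NormalSubgroup set1_subgroup set1J.

Lemma foldl_lower_central i (x : G) (xs : seq G) :
  lower_central i x -> lower_central (i + size xs) (foldl commg x xs).
Proof.
elim: xs x i => [|y xs IHxs] x i ix; first by rewrite addn0.
rewrite /= addnS -addSn; apply: IHxs.
by apply: sub_gen_smallest; exists x => //; exists y.
Qed.

(** If values of weight k + 1 are trivial, then the whole group is its k-th
iterated centre, and the lower central series descends at least as fast as the
iterated centres. *)
Lemma lower_central_trivial k :
  (forall (x : G) xs, size xs = k -> foldl commg x xs = 1) ->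
  lower_central k = [set (1 : G)].
Proof.
move=> triv.
have sub i j : (i + j = k)%N ->
    @lower_central G i `<=` iter j center_mod trivial_subgroup.
  elim: i j => [|i IHi] j ij.
    by move=> x _; apply/iter_center_modP => xs sxs; apply: triv; rewrite sxs -ij.
  apply: smallest_sub; first exact: normal_subgroup.
  by move=> _ [x /(IHi j.+1) ix [y _ <-]]; apply: ix; rewrite addnS.
apply/seteqP; split=> [x /(sub k 0%N)|_ ->]; first by rewrite addn0; apply.
by case: (k) => [//|i] A [Asub _]; apply: subgroup1.
Qed.

End Trivial.

Section Bounded.
Variable G : groupType.
Implicit Types (a b x y z g h : G) (K : normalSubgroup G).

Lemma commutator_setE k a : commutator_set k a =
  [set foldl commg a xs | xs in [set xs : seq G | size xs = k]].
Proof.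
apply/seteqP; split=> _ [xs sxs <-]; first by exists xs => //; rewrite /= size_tuple.
by exists (tcast sxs (in_tuple xs)) => //; rewrite val_tcast.
Qed.

(** * Finite normal subgroups containing commutator values *)

Section FiniteValues.
Variable m : nat.
Hypothesis value_fin : forall a, finite_set (commutator_set m.+1 a).

(** A value is [d, x] with d a value of lower weight, and the class of d is finite
because [d, g] is a value starting with [a]. *)
Lemma value_torsion a : forall c, commutator_set m.+1 a c -> torsion c.
Proof.
rewrite commutator_setE => _ [xs sxs <-].
case/lastP: xs sxs => // xs x; rewrite /= size_rcons => -[sxs].
rewrite foldl_rcons; apply: (@fc_commg_torsion _ m).
  apply: (sub_finite_set _ (finite_image (fun y => foldl commg a xs * y) (value_fin a))).
  move=> _ [g _ <-]; exists [~ foldl commg a xs, g].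
    rewrite commutator_setE; exists (rcons xs g); last by rewrite foldl_rcons.
    by rewrite /= size_rcons sxs.
  by rewrite commgEl mulVKg.
move=> y; apply: sub_finite_set (value_fin x) => _ [j _ <-].
rewrite commutator_setE; exists (y ^+ j :: nseq m x) => //.
by rewrite /= size_nseq.
Qed.

(** A value c = [a, x, ...] is of lower weight as a value starting with [a, x], so
that each [c, g] is one of the finitely many values starting with [a, x]. *)
Lemma value_conj_finite a :
  finite_set [set c ^ g | c in commutator_set m.+1 a & g in [set: G]].
Proof.
have fc b : forall c, commutator_set m.+1 b c -> finite_set (conj_class c).
  rewrite commutator_setE => _ [[//|x xs] [sxs] <-] /=.
  set c := foldl _ _ _.
  apply: (sub_finite_set _ (finite_image (fun y => c * y) (value_fin [~ b, x]))).
  move=> _ [g _ <-]; exists [~ c, g]; last by rewrite commgEl mulVKg.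
  rewrite commutator_setE; exists (rcons xs g); last by rewrite foldl_rcons.
  by rewrite /= size_rcons sxs.
apply: sub_finite_set (bigcup_finite (value_fin a) (fc a)).
by move=> _ [c ac [g _ <-]]; exists c => //; exists g.
Qed.

(** The normal subgroup is produced by Dicman's lemma from the union of K0 with the
conjugates of the values in question. *)
Lemma finite_normal_cover K0 a x : finite_set (normal_set K0) ->
  exists K, [/\ finite_set (normal_set K), normal_set K0 `<=` normal_set K,
    commutator_set m.+1 a `<=` normal_set K &
    commutator_set m.+1 x `<=` normal_set K].
Proof.
move=> K0fin.
pose Y b := [set c ^ g | c in commutator_set m.+1 b & g in [set: G]].
have YJ b : conj_closed (Y b).
  by move=> _ y [c bc [g _ <-]]; exists c => //; exists (g * y); rewrite ?conjgM.
have Yt b y : Y b y -> torsion y.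
  by move=> [c /value_torsion tc [g _ <-]]; apply: torsionJ.
have sY b : commutator_set m.+1 b `<=` Y b.
  by move=> c bc; exists c => //; exists 1; rewrite ?conjg1.
have [|||K [Kfin sK]] := @dicman G (normal_set K0 `|` (Y a `|` Y x)).
- by rewrite !finite_setU; split=> //; split; apply: value_conj_finite.
- move=> u y [Ku|[Yu|Yu]]; first by left; apply/nsgJ.
    by right; left; apply: YJ.
  by right; right; apply: YJ.
- move=> y [Ky|[/Yt//|/Yt//]].
  by apply: (finite_powers_torsion K0fin) => n; apply: nsgX.
exists K; split=> // y ?; apply: sK; first by left.
  by right; left; apply: sY.
by right; right; apply: sY.
Qed.

End FiniteValues.

(** * The extremal argument *)

(** Recording tuples of arguments instead of values allows comparing the values
of [b] with those of [z * b] at the same arguments.  Excluding values in [K] is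
what leaves room for one more value modulo a smaller subgroup. *)
Definition separated k K b (s : seq (k.-tuple G)) : bool :=
  all (fun xs : k.-tuple G => ~~ same_coset K 1 (foldl commg b xs)) s &&
  pairwise (fun xs ys : k.-tuple G =>
    ~~ same_coset K (foldl commg b xs) (foldl commg b ys)) s.

Lemma same_coset1 K x : same_coset K 1 x <-> normal_set K x.
Proof.
by split=> [/same_cosetP|Kx]; last apply/same_cosetP; rewrite invg1 mul1g.
Qed.

Lemma separated_sub k K0 K b s : normal_set K0 `<=` normal_set K ->
  @separated k K b s -> @separated k K0 b s.
Proof.
move=> sub.
have subc x y : ~~ same_coset K x y -> ~~ same_coset K0 x y.
  by apply: contra => /same_cosetP/sub/same_cosetP.
move=> /andP[s1 s2]; apply/andP; split.
  by apply: sub_all s1 => xs; apply: subc.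
by apply: sub_pairwise s2 => xs ys; apply: subc.
Qed.

Lemma separated_mull k K z b s : normal_set (iter k center_mod K) z ->
  @separated k K (z * b) s = @separated k K b s.
Proof.
move=> Zz.
have zb (xs : k.-tuple G) :
    same_coset K (foldl commg b xs) (foldl commg (z * b) xs).
  by apply: foldl_commg_mull; rewrite size_tuple.
have symK := same_coset_sym K; have trK := @same_coset_trans _ K.
congr (_ && _).
  by apply: eq_all => xs; rewrite -(right_trans symK trK (zb xs)).
apply: eq_pairwise => xs ys.
by rewrite -(left_trans symK trK (zb xs)) -(right_trans symK trK (zb ys)).
Qed.

Lemma finite_normal_residual m n :
  (forall a, (commutator_set m.+1 a #<= `I_n)%card) ->
  exists K, finite_set (normal_set K) /\
    forall a, commutator_set m.+1 a `<=` normal_set K.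
Proof.
move=> bound; have fin a : finite_set (commutator_set m.+1 a).
  by apply/finite_set_leP; exists n; apply: bound.
pose P j := `[< exists K, finite_set (normal_set K) /\
  forall b s, separated K b s -> (@size (m.+1.-tuple G) s <= j)%N >].
have exP : exists j, P j.
  exists n; apply/asboolP; exists (trivial_subgroup G); split.
    exact: finite_set1.
  move=> b s /andP[_ sep].
  pose v := [seq foldl commg b (val xs) | xs <- s].
  have vuniq : uniq v.
    rewrite uniq_pairwise pairwise_map; apply: sub_pairwise sep => xs ys /=.
    by apply: contra => /eqP->; apply: same_coset_refl.
  rewrite -card_le_II -(size_map (fun xs : m.+1.-tuple G => foldl commg b xs)).
  have /inj_card_eq/card_le_eql <- : {in `I_(size v) &, injective (nth 1 v)}.
    by move=> p q; rewrite !inE => pv qv /eqP; rewrite nth_uniq// => /eqP.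
  apply: card_le_trans (bound b); apply: subset_card_le => _ [p pv <-].
  by have /mapP[xs _ ->] := mem_nth 1 pv; exists xs.
(* K0 minimizes the largest number j of values separated by some b *)
have [j /asboolP[K0 [K0fin K0max]] jmin] := ex_minnP exP.
exists K0; split=> // a; rewrite commutator_setE => _ [[//|x xs] [sxs] <-] /=.
have [K [Kfin sK0 aK xK]] := finite_normal_cover fin a x K0fin.
pose Z := iter m.+1 center_mod K.
have [Za Zx] : normal_set Z a /\ normal_set Z x.
  split; apply/iter_center_modP => ys sys; [apply: aK | apply: xK];
  by rewrite commutator_setE; exists ys.
have [b [s [sep szs]]] : exists b (s : seq (m.+1.-tuple G)),
    separated K b s /\ (j <= size s)%N.
  case: j jmin {K0max} => [|j] jmin; first by exists 1, [::].
  apply: contrapT => no; suff /jmin : P j by rewrite ltnn.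
  apply/asboolP; exists K; split=> // b s sep.
  by rewrite leqNgt; apply/negP => ?; apply: no; exists b, s.
(* a value c of z b in K but not in K0 could be added to the separated values *)
have KK0 z c : normal_set Z z -> commutator_set m.+1 (z * b) c ->
    normal_set K c -> normal_set K0 c.
  move=> Zz [ys _ <-] Kc; apply: contrapT => K0c.
  move: sep; rewrite -(separated_mull b s Zz) => sep.
  have : separated K0 (z * b) (ys :: s).
    have /andP[s1 s2] := separated_sub sK0 sep.
    apply/andP; split=> /=; first by rewrite s1 andbT; apply/negP => /same_coset1.
    rewrite s2 andbT; apply/allP => ws sws.
    have /andP[/allP/(_ _ sws) + _] := sep.
    apply: contra => /same_cosetP/sK0 Kcw; apply/same_coset1.
    by have := nsgM Kc Kcw; rewrite mulVKg.
  by move/K0max; rewrite /= leqNgt ltnS szs.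
have Zcomm z w : normal_set Z z -> normal_set Z w ->
    normal_set (iter m center_mod K0) [~ z * b, w].
  move=> Zz Zw; apply/iter_center_modP => ys sys; apply: (KK0 z) => //.
    by rewrite commutator_setE; exists (w :: ys) => //=; rewrite sys.
  move: ys sys; apply/iter_center_modP; rewrite -invgR; apply: nsgV.
  exact: Zw.
move: xs sxs; apply/iter_center_modP.
have := Zcomm _ _ Za Zx; rewrite commMg => Zab.
have Zb : normal_set (iter m center_mod K0) [~ b, x].
  by have := Zcomm 1 x (nsg1 _) Zx; rewrite mul1g.
by have := nsgM Zab (nsgV Zb); rewrite mulgK => /nsgJ.
Qed.

End Bounded.

Local Open Scope quotient_scope.

(** * Passage to the quotient *)

Section Quotient.
Variables (G : groupType) (N : normalSubgroup G).
Local Notation pi := (\pi_(quotient_group N)).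

HB.instance Definition _ :=
  isUMagmaMorphism.Build G (quotient_group N) pi
    (pi_quotient1 N, @pi_quotientM G N).

Lemma pi_eq1 x : pi x = 1 <-> normal_set N x.
Proof.
rewrite -(pi_quotient1 N); split=> [/eqmodP/same_cosetP|Nx].
  by rewrite mulg1 => /nsgV; rewrite invgK.
by apply/eqmodP/same_cosetP; rewrite mulg1; apply: nsgV.
Qed.

Lemma pi_foldl_commg x xs :
  pi (foldl commg x xs) = foldl commg (pi x) (map pi xs).
Proof. by elim: xs x => //= y xs IHxs x; rewrite IHxs gmulfR. Qed.

End Quotient.

Theorem corollary1p2 (G : groupType) :
  finite_by_nilpotent G <->
  exists k n : nat, (0 < k)%N /\ (0 < n)%N /\
    forall x : G, (commutator_set k x #<= `I_n)%card.
Proof.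
split=> [[N [[n Nn] [c cnil]]]|[[|m] [n [// _ [_ bound]]]]].
  exists c.+1, n.+1; do 2!split=> //.
  move=> x; have Nle : (N #<= `I_n.+1)%card.
    by rewrite (card_le_eql Nn) card_le_II.
  apply: card_le_trans Nle; apply: subset_card_le.
  rewrite commutator_setE => _ [xs sxs <-]; apply/pi_eq1; rewrite pi_foldl_commg.
  case/lastP: xs sxs => // xs y; rewrite /= size_rcons => -[sxs].
  rewrite map_rcons foldl_rcons.
  have : lower_central c (foldl commg (\pi_(quotient_group N) x) (map \pi xs)).
    by rewrite -sxs -(size_map \pi_(quotient_group N));
      apply: (@foldl_lower_central _ 0%N).
  by rewrite cnil => ->; rewrite comm1g.
have [K [Kfin sK]] := finite_normal_residual bound.
exists K; split=> //; exists m.+1; apply: lower_central_trivial => x xs sxs.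
rewrite -[x]reprK; have -> : xs = map \pi_(quotient_group K) (map repr xs).
  by rewrite -map_comp map_id_in// => y _ /=; rewrite reprK.
rewrite -pi_foldl_commg; apply/pi_eq1/sK; rewrite commutator_setE.
by exists (map repr xs) => //; rewrite /= size_map.
Qed.
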